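(* Let $(S,\cdot)$ be a finite semigroup and $N=\lceil(6|S|+2)\log_2(|S|)\rceil$. For every $a\in S$ there exists a first-order formula $\mathbf{labelling}_a(x,y)$ with free variables $x,y$, over the signature consisting of a binary relation $<$ and unary predicates $p_1,\dots,p_N$, such that: for every complete linear ordering $\alpha$ and every additive labelling $\sigma$ from $\alpha$ to $S$, there exist subsets $X_1,\dots,X_N$ of $\alpha$ such that for all $a\in S$ and all $x<y$ in $\alpha$, $$\sigma(x,y)=a \iff (\alpha,X_1,\dots,X_N)\models\mathbf{labelling}_a(x,y),$$ where $<$ is interpreted as the order of $\alpha$ and each $p_i$ as $X_i$.
   Context: A linear ordering is complete if every nonempty subset with an upper bound has a least upper bound and every nonempty subset with a lower bound has a greatest lower bound. An additive labelling from $\alpha$ to $S$ assigns to each pair $x<y$ in $\alpha$ an element $\sigma(x,y)\in S$ with $\sigma(x,y)\sigma(y,z)=\sigma(x,z)$ for all $x<y<z$. *)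

(* Defs.v *)
From mathcomp Require Import all_boot all_order all_algebra.
From mathcomp Require Import boolp classical_sets reals exp.

Set Implicit Arguments.
Unset Strict Implicit.
Unset Printing Implicit Defensive.

Import Order.TTheory.
Local Open Scope order_scope.
Local Open Scope classical_set_scope.

(* First-order formulas (with equality) over [<] and unary predicates         *)
(* p_0, ..., p_(N-1), in well-scoped de Bruijn style: an element of           *)
(* [formula N n] is a formula whose free variables are among n given ones.    *)
(* A quantifier binds variable 0 of its body and shifts the others by one.    *)
Inductive formula (N : nat) : nat -> Type :=
| FFalse n : formula N n
| FLt n of 'I_n & 'I_n : formula N n
| FEq n of 'I_n & 'I_n : formula N n
| FPred n of 'I_N & 'I_n : formula N n
| FNot n of formula N n : formula N n
| FAnd n of formula N n & formula N n : formula N n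
| FOr n of formula N n & formula N n : formula N n
| FImply n of formula N n & formula N n : formula N n
| FForall n of formula N n.+1 : formula N n
| FExists n of formula N n.+1 : formula N n.

Fixpoint sat (N : nat) (d : Order.disp_t) (alpha : porderType d)
    (X : 'I_N -> set alpha) (n : nat) (f : formula N n) :
    n.-tuple alpha -> Prop :=
  match f in formula _ n return n.-tuple alpha -> Prop with
  | FFalse _ => fun _ => False
  | FLt _ i j => fun e => tnth e i < tnth e j
  | FEq _ i j => fun e => tnth e i = tnth e j
  | FPred _ p i => fun e => X p (tnth e i)
  | FNot _ g => fun e => ~ sat X g e
  | FAnd _ g h => fun e => sat X g e /\ sat X h e
  | FOr _ g h => fun e => sat X g e \/ sat X h e
  | FImply _ g h => fun e => sat X g e -> sat X h e
  | FForall _ g => fun e => forall x : alpha, sat X g [tuple of x :: e]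
  | FExists _ g => fun e => exists x : alpha, sat X g [tuple of x :: e]
  end.

(* [has_sup A] (resp. [has_inf A]) only says that A is nonempty and bounded   *)
(* above (resp. below).                                                       *)
Definition complete_order (d : Order.disp_t) (alpha : orderType d) : Prop :=
  (forall A : set alpha, has_sup A -> supremums A !=set0) /\
  (forall A : set alpha, has_inf A -> infimums A !=set0).

(* A labelling is only defined on the pairs x < y.                            *)
Definition additive_labelling (S : Type) (mul : S -> S -> S)
    (d : Order.disp_t) (alpha : orderType d)
    (sigma : forall x y : alpha, x < y -> S) : Prop :=
  forall (x y z : alpha) (xy : x < y) (yz : y < z),
    mul (sigma x y xy) (sigma y z yz) = sigma x z (lt_trans xy yz).

Definition log2 (R : realType) (x : R) : R := (ln x / ln 2)%R.

(* The ceiling is nonnegative, so taking the absolute value only casts it     *)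
(* from int to nat.                                                           *)
Definition num_preds (R : realType) (s : nat) : nat :=
  `|Num.ceil ((6 * s%:R + 2) * log2 (s%:R : R))%R|%N.

(* Main.v *)
Require Import Defs.
From mathcomp Require Import all_boot all_order all_algebra.
From mathcomp Require Import boolp classical_sets reals exp.
From mathcomp Require Import filter zify.

(* Let [tau] be the labelling. Give the points of [alpha] levels [0 .. 3|S|] so
   that, whenever [x < y] and [x' < y'] have the same level [k] and only levels
   [>= k] occur between them, [tau x y * tau x' y' = tau x y] (a weak form of
   Colcombet's Ramsey splits). The levels are chosen by removing the J-classes
   [J] of [S] one at a time, from the bottom. Given [J], take a maximal set [X]
   on which [tau] takes values in [J]; completeness provides cut points which,
   together with [X], separate the pairs still labelled in [J]. A limit of [tau
   w x] as [w] descends in [X] gives [c : X -> J] with [c x * tau x y = c y],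
   and two pairs within a fibre of [c] have labels stabilising the same [c x],
   which makes the first absorb the second. So [J] costs [|J| + 2 <= 3|J|]
   levels. A point [x] of level [n] stores, for each [k < n], the labels from
   [x] to the next and from the previous points of level [k], and the label
   common to all pairs leaving [x] in its class. If [k] is the least level on
   [[x, y]], then [tau x y] is the product of at most three stored values. With
   the level this fits in a word of [6|S| + 2] letters of [S]. *)

Set Implicit Arguments.
Unset Strict Implicit.
Unset Printing Implicit Defensive.

Import Order.TTheory GRing.Theory Num.Theory.

(** * Principal ideals of a finite semigroup *)

Section Ideals.
Context (S : finType) (mul : S -> S -> S) (mulA : associative mul).
Local Infix "**" := mul (at level 40, left associativity).

(** [option S] is [S] with an identity adjoined, namely [None]. *)
Definition lmul1 (u : option S) x := if u is Some a then a ** x else x.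
Definition rmul1 (v : option S) x := if v is Some b then x ** b else x.

Definition ideal (s : S) : pred S :=
  [pred t | [exists p : option S * option S, t == lmul1 p.1 (rmul1 p.2 s)]].

Lemma idealP s t :
  reflect (exists u v, t = lmul1 u (rmul1 v s)) (ideal s t).
Proof.
apply: (iffP existsP) => [[[u v] /eqP ->]|[u [v ->]]]; first by exists u, v.
by exists (u, v) => /=.
Qed.

Lemma lmul1A u x y : lmul1 u (x ** y) = lmul1 u x ** y.
Proof. by case: u => //= a; rewrite mulA. Qed.

Lemma rmul1A v x y : rmul1 v (x ** y) = x ** rmul1 v y.
Proof. by case: v => //= b; rewrite mulA. Qed.

Lemma ideal_refl s : ideal s s.
Proof. by apply/idealP; exists None, None. Qed.

Lemma ideal_mull s a t : ideal s t -> ideal s (a ** t).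
Proof.
move=> /idealP[u [v ->]]; apply/idealP; exists (Some (if u is Some b then a ** b else a)), v.
by case: u => [b|] //=; rewrite mulA.
Qed.

Lemma ideal_mulr s a t : ideal s t -> ideal s (t ** a).
Proof.
move=> /idealP[u [v ->]]; apply/idealP.
exists u, (Some (if v is Some b then b ** a else a)).
by case: u => [c|]; case: v => [b|] /=; rewrite ?mulA.
Qed.

Lemma ideal_trans s t r : ideal s t -> ideal t r -> ideal s r.
Proof.
move=> st /idealP[u [v ->]].
have: ideal s (rmul1 v t) by case: v => //= b; apply: ideal_mulr.
by case: u => //= a; apply: ideal_mull.
Qed.

(** Take [s] in [U] with the smallest ideal; inclusion and equal cardinality then make the ideals of
    [s] and [t] coincide. So [U] meets the ideal of [s] inside a single J-class. *)
Lemma ex_minimal_ideal (U : pred S) a : U a ->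
  exists2 s, U s & forall t r, U t -> ideal s t -> ideal s r -> ideal t r.
Proof.
move=> Ua; case: (arg_minnP (fun s => #|ideal s|) Ua) => s Us mins.
exists s => // t r Ut st sr.
have sub : ideal t \subset ideal s by apply/fintype.subsetP => z; apply: ideal_trans.
have eq_card : #|ideal t| = #|ideal s|.
  by apply/eqP; rewrite eqn_leq subset_leq_card //= mins.
by rewrite -[ideal t r]/(r \in ideal t) (subset_cardP eq_card sub r).
Qed.

(* Writing [t = u s v] with [s = s t] gives [t = w^n t v^n] for [w = u s]; two *)
(* powers of [w] agree on [t], so [t] lies in the left ideal of [s].            *)
Lemma right_stabilizer_absorb s t t' :
  s ** t = s -> s ** t' = s -> ideal s t -> t ** t' = t.
Proof.
move=> st st' /idealP[u [v tE]].
pose w := lmul1 u s; pose f := mul w; pose g := rmul1 v.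
have fg x : f (g x) = g (f x) by rewrite /f /g rmul1A.
have tfg : f (g t) = t by rewrite /f /g /w -lmul1A -rmul1A st -tE.
have itfg n x : f (iter n g x) = iter n g (f x).
  by elim: n => //= n <-; rewrite fg.
have tn n : iter n g (iter n f t) = t.
  by elim: n => //= n IH; rewrite -itfg IH -fg.
(* The orbit of [t] under [f] enters a cycle after [i] steps; [iter i g] brings [iter i f t] back to
   [t] and commutes with [f], so [t] itself is periodic. *)
have [i lt_i eq_i] : exists2 i, (i < order f t)%N & iter (order f t) f t = iter i f t.
  by have /trajectP[i ? ?] := looping_order f t; exists i.
pose k := (order f t - i)%N.
have k_gt0 : (0 < k)%N by rewrite subn_gt0.
have tk : iter k f t = t.
  rewrite -[in LHS](tn i).
  have comm n x : iter k f (iter n g x) = iter n g (iter k f x).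
    by elim: k {k_gt0} => //= k ->; rewrite itfg.
  by rewrite comm -iterD subnK ?(ltnW lt_i) // eq_i tn.
have wt : f t = w by rewrite /f /w -lmul1A st.
have {}tk : iter k.-1 f w = t by rewrite -wt -iterSr prednK.
have it n : iter n f w ** t' = iter n f w.
  by elim: n => /= [|n IH]; [rewrite /w -lmul1A st' | rewrite /f -mulA IH].
by rewrite -tk it.
Qed.

End Ideals.

(** * Ramsey splits *)

(** Otherwise [G] contains the complement of every fibre, hence their finite intersection, which is
    empty. *)
Lemma ultra_finite_value (T : Type) (S : finType) (G : set_system T) (f : T -> S) :
  UltraFilter G -> exists s, G [set w | f w = s]%classic.
Proof.
move=> GU; apply: contrapT => /forallNP nG.
suff allG (l : seq S) : G [set w | f w \notin l]%classic.
  by have [w /=] := filter_ex (allG (enum S)); rewrite mem_enum.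
elim: l => [|s l IH]; first by apply: filterS filterT.
have [/nG//|Gs] := in_ultra_setVsetC [set w | f w = s]%classic GU.
apply: filterS (filterI Gs IH) => w [/= /eqP ws wl].
by rewrite inE negb_or ws.
Qed.

Section Split.
Context (S : finType) (mul : S -> S -> S) (mulA : associative mul).
Context (d : Order.disp_t) (alpha : orderType d) (tau : alpha -> alpha -> S).
Context (tauM : forall x y z : alpha, (x < y)%O -> (y < z)%O ->
  mul (tau x y) (tau y z) = tau x z).
Local Infix "**" := mul (at level 40, left associativity).
Local Open Scope order_scope.
Local Open Scope classical_set_scope.

Definition nonminimal (Y : set alpha) : set alpha :=
  [set x | Y x /\ exists2 w, Y w & w < x].

(* [c x] is the limit of [tau w x] as [w] descends in [Y], along an           *)
(* ultrafilter containing all the initial segments of [Y].                    *)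
Lemma ex_left_limit (Y : set alpha) (P : S -> Prop) :
  (forall x y, Y x -> Y y -> x < y -> P (tau x y)) ->
  exists c : alpha -> S, (forall x, nonminimal Y x -> P (c x)) /\
    (forall x y, nonminimal Y x -> Y y -> x < y -> c x ** tau x y = c y).
Proof.
move=> PY; have [[x0 Yx0]|noY] := pselect (nonminimal Y !=set0); last first.
  exists (fun x => tau x x).
  by split=> [x Yx|x y Yx]; case: noY; exists x.
pose F := filter_from (nonminimal Y) (fun x => [set w | Y w /\ w < x]).
have FF : ProperFilter F.
  apply: filter_from_proper; last by move=> x [_ [w Yw wx]]; exists w.
  apply: filter_from_filter; first by exists x0.
  move=> x y Yx Yy; have [xy|yx] := leP x y; [exists x|exists y] => // w [Yw w1].
    by split; split=> //; apply: lt_le_trans xy.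
  by split; split=> //; apply: lt_trans yx.
have [G [GU FG]] := ultraFilterLemma FF.
have /choice[c cP] x := ultra_finite_value (tau^~ x) GU.
have GI x : nonminimal Y x -> G [set w | Y w /\ w < x].
  by move=> Yx; apply: FG; exists x.
exists c; split=> [x Yx|x y Yx Yy xy].
  have [w [[Yw wx] <-]] := filter_ex (filterI (GI x Yx) (cP x)).
  by apply: PY => //; case: Yx.
have [w [[[Yw wx] wcx] wcy]] := filter_ex (filterI (filterI (GI x Yx) (cP x)) (cP y)).
by rewrite -wcx -wcy tauM.
Qed.

Definition free (B : set alpha) (x y : alpha) :=
  forall z, x <= z <= y -> ~ B z.

Lemma sub_free B x y x' y' : x <= x' -> y' <= y -> free B x y -> free B x' y'.
Proof.
move=> xx' y'y fr z /andP[x'z zy']; apply: fr.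
by rewrite (le_trans xx' x'z) (le_trans zy' y'y).
Qed.

Lemma cat_free B x y z : free B x y -> free B y z -> free B x z.
Proof.
move=> xy yz w /andP[xw wz]; have [wy|yw] := leP w y.
  by apply: xy; rewrite xw.
by apply: yz; rewrite (ltW yw).
Qed.

(** An interval with reversed endpoints is empty, so the conjunction says that the stretch between
    [x] and [y], in whichever order, misses [B]. *)
Definition connected (B : set alpha) x y := free B x y /\ free B y x.

Lemma connected_sym B x y : connected B x y -> connected B y x.
Proof. by case. Qed.

Lemma connected_trans B x y z :
  connected B x y -> connected B y z -> connected B x z.
Proof. by move=> [xy yx] [yz zy]; split; [apply: cat_free yz | apply: cat_free yx]. Qed.

Lemma free_connected B lo hi x y :
  free B lo hi -> lo <= x <= hi -> lo <= y <= hi -> connected B x y.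
Proof.
move=> fr /andP[? ?] /andP[? ?].
by split; apply: sub_free fr.
Qed.

(* [B] is a set of points of the earlier, smaller levels.                     *)
Definition Ramsey_split (B : set alpha) (s : alpha -> nat) :=
  forall k lo hi, (forall z, lo <= z <= hi -> ~ B z /\ (k <= s z)%N) ->
  forall x y x' y', lo <= x -> x < y -> y <= hi -> lo <= x' -> x' < y' -> y' <= hi ->
    s x = k -> s y = k -> s x' = k -> s y' = k ->
    tau x y ** tau x' y' = tau x y.

(* The cuts separating, after each [a] of [X], the points [w] for which       *)
(* [tau a w] is outside [I] from the others.                                  *)
Definition ideal_segment (B : set alpha) (I : pred S) a : set alpha :=
  [set w | w = a \/ [/\ a < w, free B a w & ~~ I (tau a w)]].

Definition cuts B (I : pred S) (X : set alpha) : set alpha :=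
  [set t | exists2 a, X a & supremums (ideal_segment B I a) t].

Lemma supremums_le (A : set alpha) t t' : supremums A t -> supremums A t' -> t = t'.
Proof.
by move=> [ut lt] [ut' lt']; apply/le_anti; rewrite (lt _ ut') (lt' _ ut).
Qed.

Lemma supremums_gt (A : set alpha) t a :
  supremums A t -> a < t -> exists2 w, A w & a < w.
Proof.
move=> [_ lt] at_; apply: contrapT => now.
suff /lt : ubound A a by rewrite leNgt at_.
by move=> w Aw; rewrite leNgt; apply/negP => aw; apply: now; exists w.
Qed.

Definition ideal_linked (B : set alpha) (I : pred S) : set (set alpha) :=
  [set X | X `<=` ~` B /\ 
    forall x y, X x -> X y -> x < y -> free B x y -> I (tau x y)].

(** By Zorn's lemma: the condition involves two points at a time, so it passes to unions of chains.
    A [u] without conflict with [X] could be added to [X]. *)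
Lemma ex_maximal_linked B I :
  exists2 X, ideal_linked B I X & 
    forall u, ~ B u -> ~ X u ->
      exists2 x, X x & (x < u /\ free B x u /\ ~~ I (tau x u)) \/
                       (u < x /\ free B u x /\ ~~ I (tau u x)).
Proof.
have [|X [IX maxX]] := @Zorn_bigcup _ (ideal_linked B I).
  move=> F FP totF; split=> [x [Y FY Yx]|x y [Y FY Yx] [Z FZ Zy] xy frxy].
    exact: (FP _ FY).1.
  have [YZ|ZY] := totF _ _ FY FZ.
    by apply: (FP _ FZ).2 => //; apply: YZ.
  by apply: (FP _ FY).2 => //; apply: ZY.
exists X => // u nBu nXu; apply: contrapT => /forall2NP nconf.
apply: (maxX (X `|` [set u])).
  split; first by move=> x; left.
  by move=> /(_ u) h; apply: nXu; apply: h; right.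
have conf x : X x -> ~ ((x < u /\ free B x u /\ ~~ I (tau x u)) \/
                       (u < x /\ free B u x /\ ~~ I (tau u x))).
  by move=> Xx; case: (nconf x).
split=> [x [/IX.1//|->//]|x y [Xx|->] [Xy|->] xy frxy].
- exact: IX.2.
- by apply: contrapT => /negP nI; apply: (conf x Xx); left.
- by apply: contrapT => /negP nI; apply: (conf y Xy); right.
- by rewrite ltxx in xy.
Qed.

Section Step.
Context (I : pred S) (Il : forall a t, I t -> I (a ** t))
  (Ir : forall a t, I t -> I (t ** a)).
Context (B X : set alpha) (linkX : ideal_linked B I X).

(** Points of [X] with a cut in [[lo, hi]] lie below [lo]. If [b < b'] are two of them, some
    [w > b'] has [tau b w] outside [I], although [I] contains [tau b b'] and is closed under right
    multiplication. *)
Lemma cuts_inj lo hi t t' : free (B `|` X) lo hi ->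
  lo <= t <= hi -> lo <= t' <= hi -> cuts B I X t -> cuts B I X t' -> t = t'.
Proof.
move=> fr tlh t'lh [a Xa sup_t] [a' Xa' sup_t'].
suff key b b' r r' : lo <= r <= hi -> lo <= r' <= hi -> X b -> X b' ->
    supremums (ideal_segment B I b) r -> supremums (ideal_segment B I b') r' ->
    ~ b < b'.
  have eq_a : a = a'.
    apply/le_anti; rewrite !leNgt; apply/andP.
    by split; apply/negP; [apply: (key _ _ t' t) | apply: (key _ _ t t')].
  by move: sup_t; rewrite eq_a => /supremums_le; apply.
move=> rlh r'lh Xb Xb' sup_r sup_r' bb'.
have b'r : b' < r.
  have : b' <= r'.
    by case: sup_r' => + _; apply; left.
  move: rlh r'lh => /andP[lor rhi] /andP[lor' r'hi] b'r'.
  rewrite ltNge; apply/negP => rb'; apply: (fr b'); last by right.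
  by rewrite (le_trans lor rb') (le_trans b'r' r'hi).
have [w [->|[bw frw nI]] b'w] := supremums_gt sup_r b'r.
  by move: b'w; rewrite ltNge (ltW bb').
apply/negP: nI; rewrite negbK -(tauM bb' b'w); apply: Ir.
by apply: linkX.2 => //; apply: sub_free frw; rewrite // ltW.
Qed.

Context (sup_ex : forall A : set alpha, has_sup A -> supremums A !=set0).
Context (maxX : forall u, ~ B u -> ~ X u ->
  exists2 x, X x & (x < u /\ free B x u /\ ~~ I (tau x u)) \/
                   (u < x /\ free B u x /\ ~~ I (tau u x))).

(** If [tau u v] were in [I], maximality would give an [a] in [X] in conflict with [u]. It cannot
    lie on the right, beyond [v]. On the left, [tau a u] is outside [I] and [tau a v] inside, so the
    supremum of the segment of [a], which exists by completeness, is a cut in [[u, v]]. *)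
Lemma cuts_separate u v : u < v -> free (B `|` X `|` cuts B I X) u v ->
  ~~ I (tau u v).
Proof.
move=> uv fr; apply/negP => Iuv.
have nX z : u <= z <= v -> ~ X z by move=> /fr nz Xz; apply: nz; left; right.
have nB z : u <= z <= v -> ~ B z by move=> /fr nz Bz; apply: nz; left; left.
have uin : u <= u <= v by rewrite lexx ltW.
have [a Xa [[au [frau nIau]]|[ua [frua nIua]]]] := maxX (nB _ uin) (nX _ uin); last first.
  have va : v < a by rewrite ltNge; apply/negP => av; apply: (nX a) => //; rewrite ltW.
  by move: nIua; rewrite -(tauM uv va) Ir.
have av := lt_trans au uv.
have Iav : I (tau a v) by rewrite -(tauM au uv) Il.
have ubv : ubound (ideal_segment B I a) v.
  move=> w [->|[aw fraw nIaw]]; first exact: ltW.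
  by rewrite leNgt; apply/negP => vw; move: nIaw; rewrite -(tauM av vw) Ir.
have [|t sup_t] := sup_ex (A := ideal_segment B I a).
  by split; [exists a; left | exists v].
apply: (fr t); last by right; exists a.
case: sup_t => ubt lubt; apply/andP; split; last exact: lubt.
by apply: ubt; right.
Qed.

End Step.

(** Induction on [#|U|], where [U] contains the labels still possible on intervals missing [B]. Each
    stage drops a minimal J-class from [U] and adds [X] and its cuts to [B]. *)
Lemma ex_Ramsey_split (U : pred S) (B : set alpha) :
  (forall A : set alpha, has_sup A -> supremums A !=set0) ->
  (forall a b, U (a ** b) -> U a /\ U b) ->
  (forall x y, x < y -> free B x y -> U (tau x y)) ->
  exists2 s : alpha -> nat, (forall x, s x <= 3 * #|U|)%N & Ramsey_split B s.
Proof.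
move=> sup_ex; have [m] := ubnP #|U|.
elim: m => // m IH in U B *; rewrite ltnS => leUm Uup UB.
have [a0 Ua0|U0] := pickP U; last first.
  exists (fun=> 0%N) => // k lo hi win x y x' y' lox xy yhi _ _ _ _ _ _ _.
  have := UB x y xy; rewrite U0 => nfr; exfalso; apply/notF/nfr => z /andP[xz zy].
  by case: (win z) => //; rewrite (le_trans lox xz) (le_trans zy yhi).
(* The level budget, with [j] for [#|J|] and [u] for the number of remaining labels. *)
have ar1 j u r : (r <= j -> r <= 3 * (j + u))%N by clear; lia.
have ar2 j u : (0 < j -> j.+1 <= 3 * (j + u))%N by clear; lia.
have ar3 j u r : (0 < j -> r <= 3 * u -> j.+2 + r <= 3 * (j + u))%N by clear; lia.
have [s0 Us0 mins0] := ex_minimal_ideal mulA Ua0.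
set I := ideal mul s0.
have Il a t : I t -> I (a ** t) by apply: ideal_mull.
have Ir a t : I t -> I (t ** a) by apply: ideal_mulr.
pose J := [predI U & I]; pose U' := [predD U & I].
have cardJU' : (#|J| + #|U'| = #|U|)%N by rewrite -(cardID I U).
have J_gt0 : (0 < #|J|)%N.
  by apply/card_gt0P; exists s0; apply/andP; split; last exact: ideal_refl.
have [X linkX maxX] := ex_maximal_linked B I.
set D := cuts B I X.
have [||x y xy fr|s' les' Rs'] := IH U' (B `|` X `|` D).
+ by rewrite (leq_trans _ leUm) // -cardJU' -[X in (X < _)%N]add0n ltn_add2r.
+ move=> a b /andP[nIab /Uup[Ua Ub]]; split; apply/andP; split=> //.
    by apply: contra nIab; apply: Ir.
  by apply: contra nIab; apply: Il.
+ apply/andP; split; first exact: (cuts_separate Il Ir sup_ex maxX xy fr).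
  by apply: UB => // z /fr nz Bz; apply: nz; left; left.
pose part x := [set w | X w /\ connected B x w].
have part_eq x y : connected B x y -> part x = part y.
  move=> xy; apply/predeqP => w; split=> -[Xw xw]; split=> //.
    exact: connected_trans (connected_sym xy) xw.
  exact: connected_trans xy xw.
have partJ x : forall y z, part x y -> part x z -> y < z -> J (tau y z).
  move=> y z [Xy xy] [Xz xz] yz; have [fryz _] := connected_trans (connected_sym xy) xz.
  by apply/andP; split; [apply: UB | apply: linkX.2].
(* The limit is attached to the set [part x] rather than to [x], so that all points of a component
   share it. *)
have exc Y : exists c : alpha -> S, (exists x, Y = part x) ->
    (forall x, nonminimal Y x -> J (c x)) /\
    (forall x y, nonminimal Y x -> Y y -> x < y -> c x ** tau x y = c y).
  have [[x ->]|noY] := pselect (exists x, Y = part x).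
    by have [c cP] := ex_left_limit (P := fun a => J a) (partJ x); exists c.
  by exists (fun x => tau x x) => Yx; case: noY.
have {exc}/choice[c cP] := exc.
have cJ x : nonminimal (part x) x -> c (part x) x \in enum J.
  by rewrite mem_enum; apply: (cP _ _).1; exists x.
pose lev x := index (c (part x) x) (enum J).
have lev_lt x : nonminimal (part x) x -> (lev x < #|J|)%N.
  by move=> /cJ; rewrite -index_mem -cardE.
(* Level 0 is for a least point of [X] in its component, 1 to [#|J|] for the fibres of [c],
   [#|J| + 1] for the cuts; later levels are shifted by [#|J| + 2]. *)
pose s x := if `[< X x >] then if `[< nonminimal (part x) x >] then (lev x).+1 else 0%N
  else if `[< D x >] then #|J|.+1 else (#|J|.+2 + s' x)%N.
have sX x : X x -> (s x <= #|J|)%N.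
  by move=> /asboolT; rewrite /s => ->; case: asboolP => // /lev_lt.
have sXV x : (s x <= #|J|)%N -> X x.
  rewrite /s; case: asboolP => // _; case: asboolP => _; rewrite ?ltnn //.
  by move=> /(leq_trans (leq_addr _ _)) /ltnW; rewrite ltnn.
have sD x : (s x <= #|J|.+1)%N -> ~ X x -> D x.
  rewrite /s; case: asboolP => // _; case: asboolP => // _ + _.
  by move=> /(leq_trans (leq_addr _ _)); rewrite ltnn.
(* [win] confines the class to one [B]-component, hence to one [part x], and,  *)
(* above level [#|J|], to one component of the complement of [X].              *)
exists s => [x|k lo hi win x y x' y' lox xy yhi lox' xy' yhi' sx sy sx' sy'].
  rewrite -cardJU'; have [Xx|nXx] := pselect (X x); first exact: ar1 (sX x Xx).
  rewrite /s (asboolF nXx); case: asboolP => _; last exact: ar3 (les' x).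
  exact: ar2.
have yhi_ : x <= hi by rewrite (le_trans (ltW xy)).
have lo_y : lo <= y by rewrite (le_trans lox) ?ltW.
have x'hi : x' <= hi by rewrite (le_trans (ltW xy')).
have lo_y' : lo <= y' by rewrite (le_trans lox') ?ltW.
have frB : free B lo hi by move=> z /win[].
have [kJ|Jk] := leqP k #|J|.
  have con z : lo <= z -> z <= hi -> connected B x z.
    by move=> loz zhi; apply: (free_connected frB); rewrite ?lox ?yhi_ ?loz.
  have Xk z : s z = k -> X z by move=> sz; apply: sXV; rewrite sz.
  have inY z : lo <= z -> z <= hi -> s z = k -> part x z.
    by move=> loz zhi sz; split; [apply: Xk | apply: con].
  have partE z : lo <= z -> z <= hi -> part z = part x.
    by move=> loz zhi; apply/esym/part_eq/con.
  have nonmin_gt z w : lo <= z -> z <= hi -> lo <= w -> w <= hi -> z < w ->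
      s z = k -> s w = k -> nonminimal (part x) w.
    by move=> loz zhi low whi zw sz sw; split; [apply: inY | exists z => //; apply: inY].
  (* Since [y] has [x] below it in the same part, [k] is not 0; hence all points of level [k] in the
     window are nonminimal and share one value of [c]. *)
  have nm_y : nonminimal (part x) y by apply: (nonmin_gt x).
  have sE z : lo <= z -> z <= hi -> s z = k -> nonminimal (part x) z /\ lev z = k.-1.
    have : k != 0%N.
      by rewrite -sy /s (asboolT (Xk _ sy)) partE // (asboolT nm_y).
    move=> k0 loz zhi sz; move: (sz); rewrite /s (asboolT (Xk _ sz)) partE //.
    by case: asboolP => [nm <-|_ k0']; rewrite // -k0' in k0.
  have cE z : lo <= z -> z <= hi -> s z = k -> c (part x) z = nth s0 (enum J) k.-1.
    move=> loz zhi sz; have [nm <-] := sE z loz zhi sz.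
    by rewrite /lev partE // nth_index // -{1}(partE z) // cJ // partE.
  have Px : exists x0, part x = part x0 by exists x.
  have stab z w : lo <= z -> z <= hi -> lo <= w -> w <= hi -> z < w ->
      s z = k -> s w = k -> c (part x) x ** tau z w = c (part x) x.
    move=> loz zhi low whi zw sz sw.
    rewrite (cE x) // -[in RHS](cE w) // -(cE z) //.
    by apply: (cP _ Px).2 => //; [apply: (sE _ _ _ _).1 | apply: inY].
  (* Both labels stabilise [c (part x) x], and minimality of [s0] puts [tau x y] in the ideal of
     that element. *)
  apply: (right_stabilizer_absorb mulA (stab _ _ _ _ _ _ _ _ _) (stab _ _ _ _ _ _ _ _ _)) => //.
  have /andP[Ucx Icx] := (cP _ Px).1 _ (sE x lox yhi_ sx).1.
  apply: mins0 => //; apply: (andP (partJ x x y _ _ xy)).2; exact: inY.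
have nXw z : lo <= z <= hi -> ~ X z.
  by move=> zin /sX; have [_ ks] := win z zin; rewrite leqNgt (leq_trans Jk ks).
have frBX : free (B `|` X) lo hi by move=> z zin [/(frB z zin)|/(nXw z zin)].
(* Level [#|J| + 1] has at most one point in the window, hence no pair [x < y]. *)
have [kJ1|Jk1] := leqP k #|J|.+1.
  have Dk z : lo <= z -> z <= hi -> s z = k -> D z.
    by move=> loz zhi sz; apply: sD; rewrite ?sz //; apply: nXw; rewrite loz.
  suff xy_eq : x = y by rewrite xy_eq ltxx in xy.
  by apply: (cuts_inj Ir linkX frBX); rewrite ?lox ?lo_y //; apply: Dk.
have nD z : lo <= z <= hi -> ~ D z.
  move=> zin Dz; have [_] := win z zin.
  by rewrite /s (asboolF (nXw z zin)) (asboolT Dz) leqNgt Jk1.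
have s'E z : lo <= z <= hi -> s z = (#|J|.+2 + s' z)%N.
  by move=> zin; rewrite /s (asboolF (nXw z zin)) (asboolF (nD z zin)).
apply: (Rs' (k - #|J|.+2)%N lo hi) => //.
- move=> z zin; split; first by case=> [/(frBX z zin)|/(nD z zin)].
  by have [_] := win z zin; rewrite s'E // leq_subLR.
- by rewrite -sx s'E ?lox // addKn.
- by rewrite -sy s'E ?lo_y // addKn.
- by rewrite -sx' s'E ?lox' // addKn.
- by rewrite -sy' s'E ?lo_y' // addKn.
Qed.

End Split.

(** * Recovering the labelling from a split *)

Section Recovery.
Context (S : finType) (mul : S -> S -> S) (mulA : associative mul).
Context (d : Order.disp_t) (alpha : orderType d) (tau : alpha -> alpha -> S).
Context (tauM : forall x y z : alpha, (x < y)%O -> (y < z)%O ->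
  mul (tau x y) (tau y z) = tau x z).
Context (s : alpha -> nat) (Rs : Ramsey_split mul tau set0 s).
Local Infix "**" := mul (at level 40, left associativity).
Local Open Scope order_scope.
Local Open Scope classical_set_scope.

Definition window k x y := forall w, x <= w <= y -> (k <= s w)%N.

Lemma sub_window k x y x' y' :
  x <= x' -> y' <= y -> window k x y -> window k x' y'.
Proof.
move=> xx' y'y win w /andP[x'w wy']; apply: win.
by rewrite (le_trans xx' x'w) (le_trans wy' y'y).
Qed.

Lemma window_absorb k lo hi x y x' y' : window k lo hi ->
  lo <= x -> x < y -> y <= hi -> lo <= x' -> x' < y' -> y' <= hi ->
  s x = k -> s y = k -> s x' = k -> s y' = k ->
  tau x y ** tau x' y' = tau x y.
Proof. by move=> win; apply: Rs => z zin; split=> //; apply: win. Qed.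

(** For [z < z'], [tau x z'] is the product of [tau x z] and [tau z z'], and the latter is
    absorbed. *)
Lemma window_right_const k x z z' : window k x z -> window k x z' ->
  x < z -> x < z' -> s x = k -> s z = k -> s z' = k -> tau x z = tau x z'.
Proof.
wlog zz' : z z' / z < z'.
  move=> H wz wz' xz xz' sx sz sz'; have [zz'|z'z|->//] := ltgtP z z'.
    exact: H.
  by apply/esym/H.
move=> _ win xz _ sx sz sz'.
by rewrite -(tauM xz zz') (window_absorb win) // ltW.
Qed.

Definition after k x z := [/\ x < z, s z = k & window k x z].
Definition before k y z := [/\ z < y, s z = k & window k z y].

Lemma ex_class_value x : exists e, forall z, after (s x) x z -> tau x z = e.
Proof.
have [[z0 [xz0 sz0 w0]]|no] := pselect (exists z, after (s x) x z); last first.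
  by exists (tau x x) => z az; case: no; exists z.
by exists (tau x z0) => z [xz sz w]; apply: window_right_const w w0 _ _ _ _ _.
Qed.

(** If the points of level [k] after [x] have a least one, [z] must be it. If they descend without a
    least one, any [z] and [z0] have a common [w] below them, and [tau w z = tau w z0]. *)
Lemma ex_right_value k x : exists r, forall z, after k x z ->
  (forall z', after k x z' -> z <= z') \/
    (forall z', after k x z' -> exists2 z'', after k x z'' & z'' < z') ->
  tau x z = r.
Proof.
have [[m [am minm]]|nomin] :=
    pselect (exists m, after k x m /\ forall z', after k x z' -> m <= z').
  exists (tau x m) => z az [minz|nomin].
    by congr tau; apply/le_anti; rewrite minm // minz.
  by have [w /minm mw] := nomin _ am; rewrite ltNge mw.
have [[z0 a0]|no] := pselect (exists z, after k x z); last first.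
  by exists (tau x x) => z az; case: no; exists z.
exists (tau x z0) => z az [minz|descend]; first by case: nomin; exists z.
have [w [xw sw winw] [wz wz0]] : exists2 w, after k x w & w < z /\ w < z0.
  have [zz0|z0z] := leP z z0.
    by have [w aw wz] := descend _ az; exists w; rewrite // wz (lt_le_trans wz).
  by have [w aw wz] := descend _ a0; exists w; rewrite // wz (lt_trans wz).
case: az a0 => [xz sz winz] [xz0 sz0 winz0].
rewrite -(tauM xw wz) -(tauM xw wz0); congr mul.
have [wwz wwz0] : window k w z /\ window k w z0.
  by split; [apply: sub_window winz | apply: sub_window winz0]; rewrite // ltW.
exact: window_right_const wwz wwz0 _ _ _ _ _.
Qed.

(** Absorption removes factors on the right only. So, unlike in [ex_right_value], [l] is correct
    only behind a factor [tau z z'], except when [z] is the last point before [y]. *)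
Lemma ex_left_value k y : exists l, forall z, before k y z ->
  ((forall z', before k y z' -> z' <= z) -> tau z y = l) /\
  (forall z', before k y z' -> z < z' -> tau z y = tau z z' ** l).
Proof.
have [[m [[my sm winm] maxm]]|nomax] :=
    pselect (exists m, before k y m /\ forall z', before k y z' -> z' <= m).
  exists (tau m y) => z bz; split=> [maxz|z' bz' zz'].
    by congr tau; apply/le_anti; rewrite maxm // maxz.
  have zm : z < m by rewrite (lt_le_trans zz') // maxm.
  case: bz bz' => [zy sz winz] [z'y sz' winz']; rewrite -(tauM zm my); congr mul.
  by apply: (@window_right_const k) => //; apply: sub_window winz; rewrite // ltW.
have [[t bt]|no] := pselect (exists z, before k y z); last first.
  by exists (tau y y) => z bz; case: no; exists z.
exists (tau t y) => z bz; split=> [maxz|z' bz' zz']; first by case: nomax; exists z.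
have [zt|tz] := ltP z t.
  case: bz bt bz' => [zy sz winz] [ty st wint] [z'y sz' winz'].
  rewrite -(tauM zt ty); congr mul.
  by apply: (@window_right_const k) => //; apply: sub_window winz; rewrite // ltW.
(* Here [t <= z < z'], and [tau z z'] absorbs the extra factor [tau t z']. *)
case: bz bt bz' => [zy sz winz] [ty st wint] [z'y sz' winz'].
have tz' := le_lt_trans tz zz'.
rewrite -(tauM tz' z'y) mulA (@window_absorb k t y) ?tauM // ltW //.
Qed.

Definition first k x y z :=
  [/\ x <= z <= y, s z = k & forall w, x <= w <= y -> s w = k -> z <= w].

(** From [x], go to the first point of level [k], through its class, then out to [y]; [None] means
    that the endpoint itself has level [k]. The middle factor disappears when [[x, y]] has only one
    point of level [k] or no first one. Then [u] and [v] are not both [None], whence the [Some]. *)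
Lemma ex_point_data : exists (e : alpha -> S) (r l : nat -> alpha -> S),
  forall k x y, x < y -> window k x y ->
  let u := if s x == k then None else Some (r k x) in
  let v := if s y == k then None else Some (l k y) in
  (forall z z', first k x y z -> z < z' <= y -> s z' = k ->
    tau x y = lmul1 mul u (rmul1 mul v (e z))) /\
  ((exists2 z, x <= z <= y & s z = k) ->
   ~ (exists2 z, first k x y z & exists2 z', z < z' <= y & s z' = k) ->
    Some (tau x y) = if u is Some a then Some (rmul1 mul v a) else v).
Proof.
have [e eP] := choice ex_class_value.
have [r rP] := choice (fun kx => ex_right_value kx.1 kx.2).
have [l lP] := choice (fun ky => ex_left_value ky.1 ky.2).
exists e, (fun k x => r (k, x)), (fun k y => l (k, y)) => k x y xy win u v.
have xin : x <= x <= y by rewrite lexx ltW.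
have yin : x <= y <= y by rewrite lexx ltW.
have afterP z : x < z -> z <= y -> s z = k -> after k x z.
  by move=> xz zy sz; split=> //; apply: sub_window win.
have beforeP z : x <= z -> z < y -> s z = k -> before k y z.
  by move=> xz zy sz; split=> //; apply: sub_window win.
have neP z (t : alpha) : s t != k -> s z = k -> z != t.
  by move=> st sz; apply: contraNneq st => <-; rewrite sz.
have first_min z : s x != k -> first k x y z ->
    forall z', after k x z' -> z <= z'.
  move=> sx [/andP[xz zy] sz minz] z' [xz' sz' _].
  have [z'y|yz'] := leP z' y; first by apply: minz; rewrite // (ltW xz').
  exact: le_trans zy (ltW yz').
split=> [z z' fz|[z /andP[xz zy] sz] nf].
  move=> /andP[zz' z'y] sz'; have [/andP[xz zy] sz minz] := fz.
  have zy' := lt_le_trans zz' z'y.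
  have -> : rmul1 mul v (e z) = tau z y.
    have az' : after (s z) z z'.
      by split=> //; rewrite ?sz //; apply: sub_window win.
    rewrite /v; case: eqP => [sy|/eqP sy] /=.
      by apply/esym/eP; split; rewrite ?sz //; apply: sub_window win.
    have z'y' : z' < y by rewrite lt_neqAle neP.
    have [_ /(_ z')->//] := lP (k, y) z (beforeP z xz zy' sz); first by rewrite (eP z z').
    by apply: beforeP => //; rewrite (le_trans xz) ?ltW.
  rewrite /u; case: eqP => [sx|/eqP sx] /=.
    by congr tau; apply/esym/le_anti; rewrite xz minz.
  have xz' : x < z by rewrite lt_neqAle eq_sym neP.
  rewrite -(tauM xz' zy'); congr mul; apply: (rP (k, x)); first exact: afterP.
  by left; apply: first_min.
have [[z0 f0]|nof] := pselect (exists z0, first k x y z0).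
  have uniq w : x <= w <= y -> s w = k -> w = z0.
    move=> win_ sw; have [_ _ /(_ _ win_ sw)] := f0.
    rewrite le_eqVlt => /predU1P[//|z0w]; case: nf; exists z0 => //.
    by exists w; rewrite // z0w; case/andP: win_.
  have [/andP[xz0 z0y] sz0 min0] := f0.
  have uE : s x != k -> r (k, x) = tau x z0.
    move=> sx; apply/esym/(rP (k, x)); last by left; apply: first_min.
    by apply: afterP; rewrite // lt_neqAle eq_sym neP.
  have vE : s y != k -> l (k, y) = tau z0 y.
    move=> sy; have z0y' : z0 < y by rewrite lt_neqAle neP.
    have [/(_ _)<-//] := lP (k, y) z0 (beforeP z0 xz0 z0y' sz0).
    move=> z' [z'y sz' _]; have [xz'|z'x] := leP x z'.
      by rewrite (uniq z') // xz' ltW.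
    exact: le_trans (ltW z'x) xz0.
  rewrite /u /v; case: eqP => [sx|/eqP sx]; case: eqP => [sy|/eqP sy] //=.
  - by have := xy; rewrite (uniq x) // (uniq y) // ltxx.
  - by rewrite vE // -(uniq x).
  - by rewrite uE // -(uniq y).
  - by rewrite uE // vE // tauM // lt_neqAle ?z0y ?xz0 ?[_ == z0]eq_sym neP.
(* Without a first point, [tau x z = r] for every [z] of level [k]. If [y] has another level, take
   [w < z]: then [tau x y] is the product of [tau x w], [tau w z] and [l], that is, of [r] and
   [l]. *)
have descend w : x <= w <= y -> s w = k -> exists2 w', x <= w' < w & s w' = k.
  move=> win_ sw; apply: contrapT => now; apply: nof; exists w; split=> // t tin st.
  by rewrite leNgt; apply/negP => tw; apply: now; exists t; rewrite // tw andbT; case/andP: tin.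
have sx : s x != k.
  by apply/eqP => /(descend _ xin)[w /andP[xw]]; rewrite ltNge xw.
have uE w : after k x w -> tau x w = r (k, x).
  move=> aw; apply: (rP (k, x)) => //; right=> z' [xz' sz' winz'].
  have [z'y|yz'] := leP z' y.
    have [||w' /andP[xw' w'z'] sw'] := descend z' => //; first by rewrite (ltW xz').
    exists w' => //; apply: afterP => //; last by rewrite (le_trans (ltW w'z')).
    by rewrite lt_neqAle eq_sym neP.
  exists z; last exact: le_lt_trans zy yz'.
  by apply: afterP; rewrite // lt_neqAle eq_sym neP.
rewrite /u (negPf sx) /v; case: eqP => [sy|/eqP sy] /=; congr Some.
  by apply: uE; apply: afterP.
have [||w /andP[xw wz] sw] := descend z => //; first by rewrite xz.
have xw' : x < w by rewrite lt_neqAle eq_sym neP.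
have zy' : z < y by rewrite lt_neqAle neP.
have wy := lt_trans wz zy'.
have [_ /(_ z)] := lP (k, y) w (beforeP w xw wy sw).
move=> /(_ (beforeP z xz zy' sz) wz) wE.
rewrite -(tauM xw' wy) wE mulA tauM // uE //.
by apply: afterP => //; apply: lt_trans wz.
Qed.

End Recovery.

(** * Formulas *)

Section Formulas.
Context (N : nat).

Definition colour (d : Order.disp_t) (alpha : porderType d)
    (X : 'I_N -> set alpha) (x : alpha) : {ffun 'I_N -> bool} :=
  [ffun p => `[< X p x >]].

Definition FTrue n : formula N n := FNot (FFalse N n).

Definition FLe n (i j : 'I_n) : formula N n := FOr (FLt N i j) (FEq N i j).

Definition FEx (T : finType) n (F : T -> formula N n) : formula N n :=
  foldr (fun t f => FOr (F t) f) (FFalse N n) (enum T).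

Definition FAll (T : finType) n (F : T -> formula N n) : formula N n :=
  foldr (fun t f => FAnd (F t) f) (FTrue n) (enum T).

(** As there are finitely many colours, any property of the colour of a point is a finite
    disjunction of complete descriptions by the predicates. *)
Definition FColour n (Q : pred {ffun 'I_N -> bool}) (i : 'I_n) : formula N n :=
  FEx (fun c : {ffun 'I_N -> bool} => if Q c then
    FAll (fun p => if c p then FPred p i else FNot (FPred p i))
  else FFalse N n).

Definition FColour3 n (Q : {ffun 'I_N -> bool} -> {ffun 'I_N -> bool} -> pred {ffun 'I_N -> bool})
    (i j k : 'I_n) : formula N n :=
  FEx (fun ab : {ffun 'I_N -> bool} * {ffun 'I_N -> bool} =>
    FAnd (FAnd (FColour (pred1 ab.1) i) (FColour (pred1 ab.2) j))
         (FColour (Q ab.1 ab.2) k)).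

Context (d : Order.disp_t) (alpha : orderType d) (X : 'I_N -> set alpha).

Lemma sat_FLe n (i j : 'I_n) e :
  sat X (FLe i j) e <-> (tnth e i <= tnth e j)%O.
Proof.
rewrite le_eqVlt; split=> /= [[->|->]|/predU1P[|]]; rewrite ?orbT ?eqxx //.
  by right.
by left.
Qed.

Lemma sat_FEx (T : finType) n (F : T -> formula N n) e :
  sat X (FEx F) e <-> exists t, sat X (F t) e.
Proof.
rewrite /FEx; split=> [|[t]].
  by elim: (enum T) => //= t l IH [|/IH //]; exists t.
have := mem_enum T t; elim: (enum T) => //= u l IH.
by rewrite inE => /predU1P[<-|/IH tl /tl]; [left | right].
Qed.

Lemma sat_FAll (T : finType) n (F : T -> formula N n) e :
  sat X (FAll F) e <-> forall t, sat X (F t) e.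
Proof.
rewrite /FAll; split=> [+ t|allF].
  have := mem_enum T t; elim: (enum T) => //= u l IH.
  by rewrite inE => /predU1P[<-|/IH tl] [].
by elim: (enum T) => //=; tauto.
Qed.

Lemma sat_FColour n (Q : pred {ffun 'I_N -> bool}) (i : 'I_n) e :
  sat X (FColour Q i) e <-> Q (colour X (tnth e i)).
Proof.
rewrite sat_FEx; split=> [[c]|Qc].
  case: ifP => // Qc /sat_FAll cP; suff -> : colour X (tnth e i) = c by [].
  apply/ffunP => p; rewrite ffunE; apply/asboolP/idP; have := cP p.
    by case: (c p).
  by case: (c p).
exists (colour X (tnth e i)); rewrite Qc; apply/sat_FAll => p; rewrite ffunE.
by case: asboolP.
Qed.

Lemma sat_FColour3 n Q (i j k : 'I_n) e :
  sat X (FColour3 Q i j k) e <->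
  Q (colour X (tnth e i)) (colour X (tnth e j)) (colour X (tnth e k)).
Proof.
rewrite sat_FEx; split=> [[[a b] /= []]|QX].
  by case=> /sat_FColour/= /eqP-> /sat_FColour/= /eqP-> /sat_FColour.
by exists (colour X (tnth e i), colour X (tnth e j)); do !split; apply/sat_FColour => /=.
Qed.

End Formulas.

(** * Coding words over [S] by colours *)

Lemma ex_encoding (A B : finType) : (0 < #|A|)%N -> (#|A| <= #|B|)%N ->
  exists (enc : A -> B) (dec : B -> A), cancel enc dec.
Proof.
move=> /card_gt0P[a0 _] leAB.
exists (fun a => enum_val (widen_ord leAB (enum_rank a))).
exists (fun b => nth a0 (enum A) (enum_rank b)) => a.
by rewrite enum_valK /= nth_enum_rank.
Qed.

(** The left side counts the words of [6n + 2] letters, the right side the colours. Taking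
    logarithms reduces this to the ceiling in [num_preds]. *)
Lemma num_preds_le (R : realType) n : (1 < n)%N ->
  (n ^ (6 * n + 2) <= 2 ^ num_preds R n)%N.
Proof.
move=> n1.
have n0 : (0 < n%:R :> R)%R by rewrite ltr0n ltnW.
have ln2 : (0 < ln 2 :> R)%R by rewrite ln_gt0 // ltr1n.
have leN : ((6 * n%:R + 2) * log2 (n%:R : R) <= (num_preds R n)%:R)%R.
  rewrite (le_trans (ceil_ge _)) // /num_preds.
  by have := lez_abs (Num.ceil ((6 * n%:R + 2) * log2 (n%:R : R))%R); rewrite -(ler_int R).
rewrite -(ler_nat R) !natrX -ler_ln ?posrE; last 2 first.
- by rewrite exprn_gt0.
- by rewrite exprn_gt0.
rewrite !lnXn // -[(_ *+ num_preds R n)%R]mulr_natl.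
rewrite -[X in (X <= _)%R]mulr_natl -ler_pdivrMr //.
by rewrite -mulrA natrD natrM.
Qed.

(** * The labelling formula *)

Section Label.
Context (N K : nat).
Let colours := {ffun 'I_N -> bool}.
Context (lev : nat -> pred colours) (Q1 Q2 : nat -> colours -> colours -> pred colours).

(** Explicit ordinals let [tnth] compute on the tuples of [sat], so that [sat_FLabel] ends by
    conversion. *)
Let v2 i (lti : (i < 2)%N) : 'I_2 := Ordinal lti.
Let v3 i (lti : (i < 3)%N) : 'I_3 := Ordinal lti.
Let v4 i (lti : (i < 4)%N) : 'I_4 := Ordinal lti.

Definition FBetween n (x y z : 'I_n) : formula N n := FAnd (FLe N x z) (FLe N z y).

(* In scope: [z, x, y]. *)
Definition FFirst k : formula N 3 :=
  FAnd (FAnd (FBetween (v3 (i := 1) isT) (v3 (i := 2) isT) (v3 (i := 0) isT))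
             (FColour (lev k) (v3 (i := 0) isT)))
    (FForall (FImply (FBetween (v4 (i := 2) isT) (v4 (i := 3) isT) (v4 (i := 0) isT))
       (FImply (FColour (lev k) (v4 (i := 0) isT))
         (FLe N (v4 (i := 1) isT) (v4 (i := 0) isT))))).

Definition FFirstOfTwo k : formula N 3 :=
  FAnd (FFirst k)
    (FExists (FAnd (FAnd (FLt N (v4 (i := 1) isT) (v4 (i := 0) isT))
                         (FLe N (v4 (i := 0) isT) (v4 (i := 3) isT)))
      (FColour (lev k) (v4 (i := 0) isT)))).

(** [k] is the least level attained on [[x, y]]; the final disjunction follows the two cases of
    [ex_point_data]. The second involves only two points, so [y] also fills the third place of
    [FColour3]. *)
Definition FLabel : formula N 2 :=
  FEx (fun k : 'I_K => FAnd (FAnd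
    (FExists (FAnd (FBetween (v3 (i := 1) isT) (v3 (i := 2) isT) (v3 (i := 0) isT))
                   (FColour (lev k) (v3 (i := 0) isT))))
    (FForall (FImply (FBetween (v3 (i := 1) isT) (v3 (i := 2) isT) (v3 (i := 0) isT))
       (FColour (fun c => [forall j : 'I_k, ~~ lev j c]) (v3 (i := 0) isT)))))
    (FOr
      (FExists (FAnd (FFirstOfTwo k)
         (FColour3 (Q1 k) (v3 (i := 1) isT) (v3 (i := 2) isT) (v3 (i := 0) isT))))
      (FAnd (FNot (FExists (FFirstOfTwo k)))
         (FColour3 (Q2 k) (v2 (i := 0) isT) (v2 (i := 1) isT) (v2 (i := 1) isT))))).

Context (d : Order.disp_t) (alpha : orderType d) (X : 'I_N -> set alpha).
Local Open Scope order_scope.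

Lemma sat_FLabel (col : alpha -> colours) x y : colour X =1 col ->
  let F k z := ((x <= z /\ z <= y) /\ lev k (col z)) /\
    (forall w, x <= w /\ w <= y -> lev k (col w) -> z <= w) in
  let F2 k z := F k z /\ exists z', (z < z' /\ z' <= y) /\ lev k (col z') in
  sat X FLabel [tuple x; y] <->
  exists k : 'I_K, ((exists z, (x <= z /\ z <= y) /\ lev k (col z)) /\
    (forall z, x <= z /\ z <= y -> [forall j : 'I_k, ~~ lev j (col z)])) /\
   ((exists z, F2 k z /\ Q1 k (col x) (col y) (col z)) \/
    (~ (exists z, F2 k z) /\ Q2 k (col x) (col y) (col y))).
Proof.
move=> /funext <-; rewrite /FLabel /= sat_FEx /=.
setoid_rewrite (@sat_FLe N d alpha X).
setoid_rewrite (@sat_FColour N d alpha X).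
setoid_rewrite (@sat_FColour3 N d alpha X).
exact: iff_refl.
Qed.

End Label.

Theorem theorem7 (R : realType) (S : finType) (mul : S -> S -> S)
    (mulA : associative mul) :
  let N := num_preds R #|S| in
  exists labelling : S -> formula N 2,
    forall (d : Order.disp_t) (alpha : orderType d),
      complete_order alpha ->
    forall sigma : (forall x y : alpha, (x < y)%O -> S),
      additive_labelling mul sigma ->
    exists X : 'I_N -> set alpha,
      forall (a : S) (x y : alpha) (xy : (x < y)%O),
        sigma x y xy = a <-> sat X (labelling a) [tuple x; y].
Proof.
move=> N; have [S1|S_gt1] := leqP #|S| 1.
  exists (fun=> FTrue N 2) => d alpha _ sigma _; exists (fun=> classical_sets.set0).
  by move=> a x y xy; split=> [_ []|_] //; apply: (card_le1_eqP S1).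
have /card_gt1P[a0 [b0 [_ _ ab0]]] := S_gt1.
(* [K] counts the levels 0 to [3|S|]. A word has [m.+1 = 6|S| + 2] letters: two for each level below
   that of the point, at most [6|S|], then the class value and the end marker [b0]; [a0] is
   padding. *)
pose m := (6 * #|S|).+1; pose K := (3 * #|S|).+1.
have [||enc [dec decK]] := @ex_encoding {ffun 'I_m.+1 -> S} {ffun 'I_N -> bool}.
- by rewrite card_ffun card_ord expn_gt0 ltnW.
- rewrite !card_ffun card_bool !card_ord /m -[X in (_ ^ X)%N]addn2.
  exact: num_preds_le.
pose entry (c : {ffun 'I_N -> bool}) i : S := dec c (inord i).
pose lev k : pred {ffun 'I_N -> bool} := fun c =>
  (entry c (2 * k).+1 != a0) &&
  [forall i : 'I_m.+1, ((2 * k).+1 < i)%N ==> (dec c i == a0)].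
pose u k c := if lev k c then None else Some (entry c (2 * k)%N).
pose v k c := if lev k c then None else Some (entry c (2 * k).+1).
pose Q1 a k cx cy : pred {ffun 'I_N -> bool} := fun cz =>
  a == lmul1 mul (u k cx) (rmul1 mul (v k cy) (entry cz (2 * k)%N)).
pose Q2 a k cx (cy : {ffun 'I_N -> bool}) : pred {ffun 'I_N -> bool} := fun cz =>
  Some a == if u k cx is Some b then Some (rmul1 mul (v k cz) b) else v k cz.
exists (fun a => FLabel K lev (Q1 a) (Q2 a)) => d alpha [sup_ex _] sigma sigmaM.
(* A total extension of [sigma], whose values depend on a proof of [x < y]; [a0] is a dummy. *)
pose tau x y := if boolP (x < y)%O is AltTrue xy then sigma x y xy else a0.
have tauE x y (xy : (x < y)%O) : tau x y = sigma x y xy.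
  rewrite /tau; case: {-}_ / boolP => [xy'|]; last by rewrite xy.
  by congr sigma; apply: bool_irrelevance.
have tauM x y z : (x < y)%O -> (y < z)%O -> mul (tau x y) (tau y z) = tau x z.
  by move=> xy yz; rewrite (tauE _ _ xy) (tauE _ _ yz) (tauE _ _ (lt_trans xy yz)).
have [s les Rs] : exists2 s : alpha -> nat,
    (forall x, s x <= 3 * #|S|)%N & Ramsey_split mul tau classical_sets.set0 s.
  exact: (@ex_Ramsey_split _ _ mulA _ _ _ tauM predT).
have [e [r [l rlP]]] := ex_point_data mulA tauM Rs.
(* The level of [x] is read off its word as half the position of the last      *)
(* letter different from [a0].                                                 *)
pose letter x i := if (i < 2 * s x)%N then (if odd i then l i./2 x else r i./2 x)
  else if i == (2 * s x)%N then e x else if i == (2 * s x).+1 then b0 else a0.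
pose word x : {ffun 'I_m.+1 -> S} := [ffun i : 'I_m.+1 => letter x i].
exists (fun p => [set x | enc (word x) p]%classic) => a x y xy.
have colourE z : colour (fun p => [set x | enc (word x) p]%classic) z = enc (word z).
  by apply/ffunP => p; rewrite ffunE /= asboolb.
have lt_m k : (k < K)%N -> ((2 * k).+1 < m.+1)%N by rewrite /m /K; lia.
have sK z : (s z < K)%N by rewrite ltnS.
have entryE z i : (i < m.+1)%N -> entry (enc (word z)) i = letter z i.
  by move=> im; rewrite /entry decK ffunE inordK.
have letter_b z : letter z (2 * s z).+1 = b0.
  by rewrite /letter ltnNge leqnSn /= gtn_eqF // eqxx.
have letter_a z i : ((2 * s z).+1 < i)%N -> letter z i = a0.
  move=> lti; have lti' : (2 * s z < i)%N by apply: ltnW.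
  by rewrite /letter ltnNge ltnW // !gtn_eqF.
have levE z k : (k < K)%N -> lev k (enc (word z)) = (s z == k).
  move=> kK; rewrite /lev entryE ?lt_m //; apply/andP/eqP => [[ka /forallP ak]|<-]; last first.
    rewrite letter_b eq_sym ab0; split=> //; apply/forallP => i; apply/implyP => lti.
    by rewrite decK ffunE letter_a.
  have [sk|ks|//] := ltngtP (s z) k; first by rewrite letter_a ?eqxx // in ka; lia.
  have /implyP := ak (inord (2 * s z).+1); rewrite decK ffunE inordK ?lt_m // letter_b.
  by rewrite eq_sym (negPf ab0) => /(_ _)/negP[]; lia.
have uE z k : (k < K)%N -> (k <= s z)%N ->
    u k (enc (word z)) = if s z == k then None else Some (r k z).
  move=> kK kz; rewrite /u levE //; case: eqP => // /eqP nk; congr Some.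
  rewrite entryE ?(ltnW (lt_m _ kK)) // /letter ifT; last by lia.
  by rewrite oddM /= mul2n doubleK.
have vE z k : (k < K)%N -> (k <= s z)%N ->
    v k (enc (word z)) = if s z == k then None else Some (l k z).
  move=> kK kz; rewrite /v levE //; case: eqP => // /eqP nk; congr Some.
  rewrite entryE ?lt_m // /letter ifT; last by lia.
  by rewrite /= oddM /= mul2n uphalf_double.
have eE z k : s z = k -> entry (enc (word z)) (2 * k)%N = e z.
  by move=> <-; rewrite entryE ?(ltnW (lt_m _ (sK z))) // /letter ltnn eqxx.
have geE z k : (k < K)%N ->
    [forall j : 'I_k, ~~ lev j (enc (word z))] = (k <= s z)%N.
  move=> kK; apply/forallP/idP => [nlev|kz j].
    rewrite leqNgt; apply/negP => zk; have := nlev (Ordinal zk).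
    by rewrite levE ?sK //= eqxx.
  by rewrite levE ?(ltn_trans (ltn_ord j)) // gtn_eqF // (leq_trans _ kz).
rewrite -(tauE _ _ xy) (sat_FLabel _ _ _ _ _ _ colourE).
have bet z : (x <= z /\ z <= y)%O <-> (x <= z <= y)%O by split=> /andP.
have firstP k z : (k < K)%N -> first s k x y z <->
    (((x <= z /\ z <= y)%O /\ lev k (enc (word z))) /\
    (forall w, (x <= w /\ w <= y)%O -> lev k (enc (word w)) -> (z <= w)%O)).
  move=> kK; split=> [[/andP zin sz minz]|[[/andP zin]]].
    split; first by rewrite levE ?sz.
    by move=> w /andP win; rewrite levE // => /eqP; apply: minz.
  rewrite levE // => /eqP sz minz; split=> // w /andP win /eqP sw.
  by apply: minz; rewrite ?levE.
(* [P] will be the colour version of being the first of at least two points of level [k], so that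
   [main] matches the form of [sat_FLabel]. *)
have main k (P : alpha -> Prop) :
    (forall z, (first s k x y z /\ exists z', (z < z' /\ z' <= y)%O /\ s z' = k) <-> P z) ->
    (k < K)%N -> (exists2 z, (x <= z <= y)%O & s z = k) -> window s k x y ->
    (tau x y = a <->
     (exists z, P z /\
        Q1 a k (enc (word x)) (enc (word y)) (enc (word z))) \/
     (~ (exists z, P z) /\
        Q2 a k (enc (word x)) (enc (word y)) (enc (word y)))).
  move=> /predeqP <- kK exk win; have [val1 val2] := rlP k x y xy win.
  have kx : (k <= s x)%N by apply: win; rewrite lexx ltW.
  have ky : (k <= s y)%N by apply: win; rewrite lexx ltW.
  rewrite /Q1 /Q2 !uE // !vE //.
  have val1' z : first s k x y z /\ (exists z', (z < z' /\ z' <= y)%O /\ s z' = k) ->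
      tau x y = lmul1 mul (if s x == k then None else Some (r k x))
        (rmul1 mul (if s y == k then None else Some (l k y)) (entry (enc (word z)) (2 * k)%N)).
    move=> [fz [z' [/andP zz' sz']]]; have [_ sz _] := fz.
    by rewrite (eE z) // (val1 z z').
  have val2' : ~ (exists z, first s k x y z /\ exists z', (z < z' /\ z' <= y)%O /\ s z' = k) ->
      ~ (exists2 z, first s k x y z & exists2 z', (z < z' <= y)%O & s z' = k).
    by apply: contra_not => -[z fz [z' /andP zz' sz']]; exists z; split=> //; exists z'.
  split=> [<-|[[z [fz /eqP->]]|[/val2' nf /eqP]]]; last 2 first.
  - exact: val1' fz.
  - by rewrite -val2 // => -[].
  have [[z fz]|nf] := pselect (exists z, first s k x y z /\
      exists z', (z < z' /\ z' <= y)%O /\ s z' = k).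
    by left; exists z; split=> //; apply/eqP/val1'.
  by right; split=> //; apply/eqP/val2 => //; apply: val2'.
pose attained n := `[< exists2 z, (x <= z <= y)%O & s z = n >].
have ex_attained : exists n, attained n.
  by exists (s x); apply/asboolP; exists x; rewrite // lexx ltW.
have F2P k : (k < K)%N -> forall z,
    (first s k x y z /\ exists z', (z < z' /\ z' <= y)%O /\ s z' = k) <->
    (((x <= z /\ z <= y)%O /\ lev k (enc (word z))) /\
      (forall w, (x <= w /\ w <= y)%O -> lev k (enc (word w)) -> (z <= w)%O)) /\
    (exists z', (z < z' /\ z' <= y)%O /\ lev k (enc (word z'))).
  move=> kK z; rewrite firstP //; split=> -[? [z' [zz' sz']]]; split=> //; exists z'.
    by rewrite levE // sz' eqxx.
  by move: sz'; rewrite levE // => /eqP.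
split=> [tau_a|[[k kK] /= [[[z [/bet zin]]]]]].
  have [k /asboolP[z zin sz] kmin] := ex_minnP ex_attained.
  have kK : (k < K)%N by rewrite -sz sK.
  have win : window s k x y by move=> w win; apply: kmin; apply/asboolP; exists w.
  exists (Ordinal kK) => /=; split.
    split; first by exists z; rewrite bet levE // sz.
    by move=> w /bet /win; rewrite geE.
  exact: (main k _ (F2P k kK) kK (ex_intro2 _ _ z zin sz) win).1.
rewrite levE // => /eqP sz win.
apply: (main k _ (F2P k kK) kK (ex_intro2 _ _ z zin sz) _).2.
by move=> w /bet /win; rewrite geE.
Qed.
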